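(* In the coordinator's problem described in the context, the value functions for the coordinator's dynamic program are as follows, for probability distributions $\pi^1$ on $\mathcal X^1$ and $\pi^2$ on $\mathcal X^2$: $V_{T+1}(\pi^1,\pi^2):=0$ for all $\pi^1,\pi^2$, and for $t=T,\dots,2,1$, $$V_{t^+}(\pi^1,\pi^2):=\min_{\lambda^1,\lambda^2}\Big[\sum_{x^1,x^2}c_t\big(x^1,x^2,\lambda^1(x^1),\lambda^2(x^2)\big)\pi^1(x^1)\pi^2(x^2)+V_{t+1}\big(\beta_t(\pi^{1,2},\lambda^{1,2})\big)\Big],$$ $$V_t(\pi^1,\pi^2):=\min_{\gamma^1,\gamma^2}\Big[\rho\sum_{x^1,x^2}\max(\gamma^1(x^1),\gamma^2(x^2))\pi^1(x^1)\pi^2(x^2)+P(Z_t=\phi\mid\pi^{1,2},\gamma^{1,2})\,V_{t^+}\big(\eta_t(\pi^{1,2},\gamma^{1,2},\phi)\big)$$ $$\qquad\qquad+\sum_{\tilde x^1,\tilde x^2}P(Z_t=(\tilde x^1,\tilde x^2)\mid\pi^{1,2},\gamma^{1,2})\,V_{t^+}(\delta_{\tilde x^1},\delta_{\tilde x^2})\Big],$$ where the minima are over functions $\lambda^i:\mathcal X^i\to\mathcal U^i$ and $\gamma^i:\mathcal X^i\to\{0,1\}$. The coordinator's optimal strategy is to pick the minimizing prescription pairs for each time and each $(\pi^1,\pi^2)$: the coordinator strategy that at each time $t$ uses a pair $(\gamma^1,\gamma^2)$ attaining the minimum in $V_t$ at $(\pi^1,\pi^2)=(\Pi^1_t,\Pi^2_t)$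 and then a pair $(\lambda^1,\lambda^2)$ attaining the minimum in $V_{t^+}$ at $(\pi^1,\pi^2)=(\Pi^1_{t^+},\Pi^2_{t^+})$ minimizes the expected total cost among all coordinator strategies.
   Context: Two agents $i=1,2$ operate over times $t=1,\dots,T$, with local states $X^i_t\in\mathcal X^i$ and control actions $U^i_t\in\mathcal U^i$ ($\mathcal X^i,\mathcal U^i$ finite); $X_t=(X^1_t,X^2_t)$, $U_t=(U^1_t,U^2_t)$. Dynamics: $X^i_{t+1}=k^i_t(X^i_t,U^i_t,W^i_t)$ with given functions $k^i_t$, where $W^i_t$ has distribution $P_{W^i}$ and $X^i_1$ has distribution $P_{X^i_1}$; the variables $X^1_1,X^2_1$ and $W^i_t$ ($i=1,2$, $t\ge 1$) are mutually independent. At each $t$, communication decisions $M^1_t,M^2_t\in\{0,1\}$ are made first; with $M^{or}_t=\max(M^1_t,M^2_t)$, the exchanged information is $Z_t=(X^1_t,X^2_t)$ if $M^{or}_t=1$ and $Z_t=\phi$ (a blank symbol) otherwise; then control actions are chosen. The common information is $C_t=(Z_{1:t-1},M^{1,2}_{1:t-1})$ before communication and $C_{t^+}=(Z_{1:t},M^{1,2}_{1:t})$ after it. The superscript ''$1,2$'' denotes the pair of quantities for the two agents. Coordinator's problem: a fictitious coordinator observes only the common information. Before communication at time $t$ it selects prescriptions $\Gamma_t=(\Gamma^1_t,\Gamma^2_t)$, $\Gamma^i_t:\mathcal X^i\to\{0,1\}$, as $\Gamma^i_t=d^i_t(C_t)$, and then $M^i_t=\Gamma^i_t(X^i_t)$.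 After $Z_t$ is realized it selects $\Lambda_t=(\Lambda^1_t,\Lambda^2_t)$, $\Lambda^i_t:\mathcal X^i\to\mathcal U^i$, as $\Lambda^i_t=d^i_{t^+}(C_{t^+})$, and then $U^i_t=\Lambda^i_t(X^i_t)$. The collection of functions $(d^i_t,d^i_{t^+})_{i,t}$ is the coordinator's strategy; the aim is to minimize $\mathbb E\big[\sum_{t=1}^T\big(c_t(X_t,U_t)+\rho\mathbf 1_{\{M^{or}_t=1\}}\big)\big]$, where $c_t$ are given real-valued cost functions and $\rho$ is a given communication cost. Beliefs: $\Pi^i_t(x)=P(X^i_t=x\mid C_t,\Gamma_{1:t-1},\Lambda_{1:t-1})$ and $\Pi^i_{t^+}(x)=P(X^i_t=x\mid C_{t^+},\Gamma_{1:t},\Lambda_{1:t-1})$. The coordinator's belief on $(X^1_t,X^2_t)$ is the product of these. Update maps: $\eta_t(\pi^{1,2},\gamma^{1,2},z)$ denotes the pair $\eta^i_t(\pi^i,\gamma^i,z)$, $i=1,2$, with $$\eta^i_t(\pi^i,\gamma^i,\phi)(x)=\frac{\mathbf 1_{\{\gamma^i(x)=0\}}\pi^i(x)}{\sum_{\hat x}\mathbf 1_{\{\gamma^i(\hat x)=0\}}\pi^i(\hat x)},\qquad \eta^i_t(\pi^i,\gamma^i,(\tilde x^1,\tilde x^2))=\delta_{\tilde x^i},$$ and $\beta_t(\pi^{1,2},\lambda^{1,2})$ denotes the pair $\beta^i_t(\pi^i,\lambda^i)$, $i=1,2$, with $$\beta^i_t(\pi^i,\lambda^i)(x')=\sum_{x}P\big(k^i_t(x,\lambda^i(x),W^i_t)=x'\big)\pi^i(x).$$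 If the denominator in $\eta^i_t(\cdot,\cdot,\phi)$ is zero, then $P(Z_t=\phi\mid\cdot)=0$ and the corresponding term in the recursion is zero. Here $\delta_x$ is the point mass at $x$. Probabilities: $$P(Z_t=\phi\mid\pi^{1,2},\gamma^{1,2})=\sum_{x^1,x^2}\mathbf 1_{\{\gamma^1(x^1)=0\}}\mathbf 1_{\{\gamma^2(x^2)=0\}}\pi^1(x^1)\pi^2(x^2),$$ $$P(Z_t=(x^1,x^2)\mid\pi^{1,2},\gamma^{1,2})=\max(\gamma^1(x^1),\gamma^2(x^2))\,\pi^1(x^1)\pi^2(x^2).$$ *)

(* Defs.v *)
From HB Require Import structures.
From mathcomp Require Import all_boot all_order all_algebra.
From mathcomp Require Import all_classical all_reals all_analysis.
Set Implicit Arguments.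
Unset Strict Implicit.
Unset Printing Implicit Defensive.
Import Order.TTheory GRing.Theory Num.Theory.
Local Open Scope classical_set_scope.
Local Open Scope ring_scope.

Section FiniteMin.
Variables (R : realType) (I : finType).
Implicit Types F : I -> R.

(* The value 0 on an empty index type is junk and is never used below. *)
Definition min_over F : R :=
  if [pick i : I] is Some i0 then F [arg min_(i < i0) F i]%O else 0.

Definition minimizes F (i : I) : Prop := F i = min_over F.

Lemma min_overP F (i0 : I) :
  (exists i, F i = min_over F) /\ (forall j, min_over F <= F j).
Proof.
rewrite /min_over; case: pickP => [i1 _|/(_ i0)//].
by case: arg_minP => // i _ Hi; split; [exists i|move=> j; exact: Hi].
Qed.

End FiniteMin.

Section Independence.
Context d (Omega : measurableType d) (R : realType) (P : probability Omega R).

(* An injective [j] enumerates an arbitrary finite subfamily. *)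
Definition mutually_independent (I : Type) (F : I -> set (set Omega)) : Prop :=
  forall (n : nat) (j : 'I_n -> I) (A : 'I_n -> set Omega),
    injective j -> (forall k, F (j k) (A k)) ->
    P (\bigcap_(k in [set: 'I_n]) A k) = (\prod_(k < n) P (A k))%E.

(* Conditional probability; 0 when [B] has probability 0. *)
Definition cond_prob (A B : set Omega) : R := fine (P (A `&` B)) / fine (P B).

End Independence.

Section SingleAgent.
Context (R : realType) (X U : finType) dW (W : measurableType dW).

(* Time indices are those of the problem, 1, ..., T; the value of [dyn] at
   time 0 is never used. *)
Record agent := Agent {
  dyn : nat -> X -> U -> W -> X;
  noise_law : probability W R;
  init_law : {ffun X -> R};
  dyn_measurable : forall t x u x', measurable [set w | dyn t x u w = x']
}.

Definition point_mass (x : X) : {ffun X -> R} := [ffun y => (y == x)%:R].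

(* [None] is the blank symbol, and [Some x] carries the agent's own component
   of the revealed pair of states. When the denominator vanishes the result is
   the zero function (division by 0 yields 0). *)
Definition eta_agent (p : {ffun X -> R}) (g : {ffun X -> bool})
    (z : option X) : {ffun X -> R} :=
  if z is Some x then point_mass x
  else [ffun x => (~~ g x)%:R * p x / \sum_(y : X) (~~ g y)%:R * p y].

Definition beta_agent (a : agent) (t : nat) (p : {ffun X -> R})
    (l : {ffun X -> U}) : {ffun X -> R} :=
  [ffun x' => \sum_(x : X)
     fine (noise_law a [set w | dyn a t x (l x) w = x']) * p x].

Record agent_primitives (a : agent) d (Omega : measurableType d)
    (P : probability Omega R) := AgentPrimitives {
  init : Omega -> X;
  noise : nat -> Omega -> W;
  init_measurable : forall x, measurable [set w | init w = x];
  initP : forall x, P [set w | init w = x] = (init_law a x)%:E;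
  noise_measurable : forall t, (0 < t)%N -> measurable_fun setT (noise t);
  noiseP : forall t, (0 < t)%N -> forall A, measurable A ->
    P (noise t @^-1` A) = noise_law a A
}.

End SingleAgent.

Section Team.
Context (R : realType) (X1 X2 U1 U2 : finType).
Context dW1 (W1 : measurableType dW1) dW2 (W2 : measurableType dW2).

Record model := Model {
  agent1 : agent R X1 U1 W1;
  agent2 : agent R X2 U2 W2;
  cost : nat -> X1 -> X2 -> U1 -> U2 -> R;
  rho : R;
  horizon : nat
}.

Definition belief : Type := ({ffun X1 -> R} * {ffun X2 -> R})%type.

(* Prescription pairs (Gamma^1, Gamma^2) and (Lambda^1, Lambda^2); the
   communication decisions {0, 1} are booleans. *)
Definition comm_presc : finType := ({ffun X1 -> bool} * {ffun X2 -> bool})%type.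
Definition ctrl_presc : finType := ({ffun X1 -> U1} * {ffun X2 -> U2})%type.

(* One period (Z_t, (M^1_t, M^2_t)) of common information; Z_t is [None] when
   blank. C_t is the chronological list of the first t - 1 such periods, and
   C_{t+} that of the first t. *)
Definition message : finType := option (X1 * X2)%type.
Definition period : finType := (message * (bool * bool))%type.

Record strategy := Strategy {
  d_comm : nat -> seq period -> comm_presc;
  d_ctrl : nat -> seq period -> ctrl_presc
}.

Section DynamicProgram.
Variable M : model.
Local Notation T := (horizon M).

Definition eta (p : belief) (g : comm_presc) (z : message) : belief :=
  (eta_agent p.1 g.1 (omap fst z), eta_agent p.2 g.2 (omap snd z)).

Definition beta (t : nat) (p : belief) (l : ctrl_presc) : belief :=
  (beta_agent (agent1 M) t p.1 l.1, beta_agent (agent2 M) t p.2 l.2).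

Definition prob_blank (p : belief) (g : comm_presc) : R :=
  \sum_(x1 : X1) \sum_(x2 : X2)
    (~~ g.1 x1)%:R * (~~ g.2 x2)%:R * p.1 x1 * p.2 x2.

Definition prob_reveal (p : belief) (g : comm_presc) (x1 : X1) (x2 : X2) : R :=
  (g.1 x1 || g.2 x2)%:R * p.1 x1 * p.2 x2.

Definition ctrl_objective (t : nat) (Vnext : belief -> R) (p : belief)
    (l : ctrl_presc) : R :=
  \sum_(x1 : X1) \sum_(x2 : X2)
     cost M t x1 x2 (l.1 x1) (l.2 x2) * p.1 x1 * p.2 x2
  + Vnext (beta t p l).

Definition comm_objective (Vplus : belief -> R) (p : belief)
    (g : comm_presc) : R :=
  rho M * (\sum_(x1 : X1) \sum_(x2 : X2)
             (g.1 x1 || g.2 x2)%:R * p.1 x1 * p.2 x2)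
  + prob_blank p g * Vplus (eta p g None)
  + \sum_(x1 : X1) \sum_(x2 : X2)
      prob_reveal p g x1 x2 * Vplus (point_mass R x1, point_mass R x2).

(* [value_to_go n] is V_t for t = T + 1 - n, that is, with n periods left. The
   value functions are defined for all pairs of functions, so that no proof
   that an argument is a probability distribution has to be carried; the only
   non-distribution that arises from distributions is the zero function given
   by a vanishing denominator in [eta], and there [prob_blank] is 0. *)
Fixpoint value_to_go (n : nat) : belief -> R :=
  if n is m.+1 then
    fun p => min_over (comm_objective
      (fun q => min_over (ctrl_objective (T - m) (value_to_go m) q)) p)
  else fun _ => 0.

Definition V (t : nat) : belief -> R := value_to_go (T.+1 - t).

Definition Vplus (t : nat) (p : belief) : R :=
  min_over (ctrl_objective t (V t.+1) p).

Lemma V_last p : V T.+1 p = 0.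
Proof. by rewrite /V subnn. Qed.

Lemma V_rec t p : (1 <= t <= T)%N ->
  V t p = min_over (comm_objective (Vplus t) p).
Proof.
by move=> /andP[_ tT]; rewrite {1}/V subSn //= subKn.
Qed.

End DynamicProgram.

Section Process.
Context (M : model) d (Omega : measurableType d) (P : probability Omega R).
Local Notation T := (horizon M).

(* The noises occurring in the dynamics are W^i_t with t >= 1, so [Noise1 n]
   and [Noise2 n] stand for W^1_{n+1} and W^2_{n+1}. *)
Inductive source := Init1 | Init2 | Noise1 of nat | Noise2 of nat.

Definition source_events (S1 : agent_primitives (agent1 M) P)
    (S2 : agent_primitives (agent2 M) P) (s : source) : set (set Omega) :=
  match s with
  | Init1 => [set init S1 @^-1` B | B in [set: set X1]]
  | Init2 => [set init S2 @^-1` B | B in [set: set X2]]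
  | Noise1 n => [set noise S1 n.+1 @^-1` B | B in measurable]
  | Noise2 n => [set noise S2 n.+1 @^-1` B | B in measurable]
  end.

Record primitives := Primitives {
  prim1 : agent_primitives (agent1 M) P;
  prim2 : agent_primitives (agent2 M) P;
  prim_independent : mutually_independent P (source_events prim1 prim2)
}.

Variables (S : primitives) (s : strategy).

Definition announce (g : comm_presc) (x : X1 * X2) : period :=
  (if g.1 x.1 || g.2 x.2 then Some x else None, (g.1 x.1, g.2 x.2)).

(* [trajectory w n] is (X_t, C_t) at time t = n + 1. *)
Fixpoint trajectory (w : Omega) (n : nat) : (X1 * X2) * seq period :=
  if n is m.+1 then
    let: (x, h) := trajectory w m in
    let h' := rcons h (announce (d_comm s n h) x) in
    let l := d_ctrl s n h' in
    ((dyn (agent1 M) n x.1 (l.1 x.1) (noise (prim1 S) n w),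
      dyn (agent2 M) n x.2 (l.2 x.2) (noise (prim2 S) n w)), h')
  else ((init (prim1 S) w, init (prim2 S) w), [::]).

Definition Xt (t : nat) (w : Omega) : X1 * X2 := (trajectory w t.-1).1.
Definition Ct (t : nat) (w : Omega) : seq period := (trajectory w t.-1).2.
Definition Gammat (t : nat) (w : Omega) : comm_presc := d_comm s t (Ct t w).
Definition Mt (t : nat) (w : Omega) : bool * bool :=
  ((Gammat t w).1 (Xt t w).1, (Gammat t w).2 (Xt t w).2).
Definition Mort (t : nat) (w : Omega) : bool := (Mt t w).1 || (Mt t w).2.
Definition Zt (t : nat) (w : Omega) : message :=
  if Mort t w then Some (Xt t w) else None.
Definition Ctplus (t : nat) (w : Omega) : seq period :=
  rcons (Ct t w) (Zt t w, Mt t w).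
Definition Lambdat (t : nat) (w : Omega) : ctrl_presc :=
  d_ctrl s t (Ctplus t w).
Definition Ut (t : nat) (w : Omega) : U1 * U2 :=
  ((Lambdat t w).1 (Xt t w).1, (Lambdat t w).2 (Xt t w).2).

Lemma Xt_next t w : (1 <= t)%N ->
  Xt t.+1 w =
  (dyn (agent1 M) t (Xt t w).1 (Ut t w).1 (noise (prim1 S) t w),
   dyn (agent2 M) t (Xt t w).2 (Ut t w).2 (noise (prim2 S) t w)).
Proof.
case: t => // n _.
rewrite /Ut /Lambdat /Ctplus /Zt /Mort /Mt /Gammat /Xt /Ct /=.
by case: (trajectory w n).
Qed.

Lemma Ct_next t w : (1 <= t)%N -> Ct t.+1 w = Ctplus t w.
Proof.
case: t => // n _; rewrite /Ctplus /Zt /Mort /Mt /Gammat /Xt /Ct /=.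
by case: (trajectory w n).
Qed.

(* The conditioning variables (C_t, Gamma_{1:t-1}, Lambda_{1:t-1}) of Pi_t and
   (C_{t+}, Gamma_{1:t}, Lambda_{1:t-1}) of Pi_{t+}. *)
Definition info (t : nat) (w : Omega) :
    seq period * seq comm_presc * seq ctrl_presc :=
  (Ct t w, [seq Gammat r w | r <- iota 1 t.-1],
   [seq Lambdat r w | r <- iota 1 t.-1]).
Definition info_plus (t : nat) (w : Omega) :
    seq period * seq comm_presc * seq ctrl_presc :=
  (Ctplus t w, [seq Gammat r w | r <- iota 1 t],
   [seq Lambdat r w | r <- iota 1 t.-1]).

Definition belief_given (E : set Omega) (t : nat) : belief :=
  ([ffun x => cond_prob P [set v | (Xt t v).1 = x] E],
   [ffun x => cond_prob P [set v | (Xt t v).2 = x] E]).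

Definition Pit (t : nat) (w : Omega) : belief :=
  belief_given [set v | info t v = info t w] t.
Definition Pitplus (t : nat) (w : Omega) : belief :=
  belief_given [set v | info_plus t v = info_plus t w] t.

Definition realized_cost (w : Omega) : R :=
  \sum_(1 <= t < T.+1)
    (cost M t (Xt t w).1 (Xt t w).2 (Ut t w).1 (Ut t w).2
     + rho M * (Mort t w)%:R).

Definition expected_cost : \bar R := 'E_P[realized_cost]%E.

(* Required almost surely only: on histories of probability 0 the conditional
   probabilities defining the beliefs are meaningless. *)
Definition picks_minimizers : Prop :=
  forall t, (1 <= t <= T)%N ->
    {ae P, forall w,
       minimizes (comm_objective M (Vplus M t) (Pit t w)) (Gammat t w) /\
       minimizes (ctrl_objective M t (V M t.+1) (Pitplus t w)) (Lambdat t w)}.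

End Process.

End Team.

(* Main.v *)
Require Import Defs.
From mathcomp Require Import all_boot all_order all_algebra.
From mathcomp Require Import all_classical all_reals all_analysis.

(** The coordinator faces a partially observed decision problem whose state is
    the pair of local states and whose observation is the common information.
    Three facts make the product of the two beliefs a sufficient statistic.

    - At every time the current and future noises are independent of the
      current states and common history, for those are functions of the initial
      states and of the past noises ([pr_future]).

    - Conditionally on any history of positive probability the two local states
      are independent, and their laws are updated by [eta] when the agents
      communicate and by [beta] when they act ([posterior_comm],
      [posterior_ctrl]). The blank message keeps independence because staying
      silent is the conjunction of one event per agent; a revealed state makes
      the law a point mass; and the agents move with independent noises. Hence
      along histories of positive probability the beliefs [Pit] and [Pitplus]
      are the product laws so computed.

    - Backward induction then compares, on each history of positive probability,
      the cost still to be paid with the value function at the belief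
      ([cost_from_ge_V]): for any strategy the former is at least the latter,
      since the prescriptions in use are only one candidate in each of the two
      minima, and there is equality when they attain these minima. At time 1
      the history is empty and the belief is the initial law, so the value
      there bounds every expected cost and is attained by any strategy that
      picks minimizers.

    Such a strategy exists: prescriptions are functions of the whole history, so
    the strategy can recompute from it, period by period, the belief that its
    own past prescriptions have produced, and then minimize. The histories on
    which the recomputed belief may fail to be the conditional law have
    probability 0, and there are countably many histories. *)

Set Implicit Arguments.
Unset Strict Implicit.
Unset Printing Implicit Defensive.
Import Order.TTheory GRing.Theory Num.Theory.
Local Open Scope classical_set_scope.
Local Open Scope ring_scope.

(** * Finite-valued maps on a probability space *)

Section DiscreteVariables.
Context d (Omega : measurableType d) (R : realType) (P : probability Omega R).

Definition pr (A : set Omega) : R := fine (P A).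

Lemma prE A : measurable A -> P A = (pr A)%:E.
Proof. by move=> mA; rewrite /pr fineK// fin_num_measure. Qed.

Lemma pr_ge0 A : 0 <= pr A.
Proof. exact: fine_ge0. Qed.

Lemma pr0 : pr set0 = 0.
Proof. by rewrite /pr measure0. Qed.

Lemma prT : pr setT = 1.
Proof. by rewrite /pr probability_setT. Qed.

Lemma measurable_fibres (Y : countType) (g : Omega -> Y) (Q : set Y) :
  (forall y, measurable [set w | g w = y]) -> measurable [set w | Q (g w)].
Proof.
move=> mg.
rewrite (_ : [set w | _] = \bigcup_y ([set w | g w = y] `&` [set _ | Q y])).
  apply: countable_bigcupT_measurable => // y.
  by apply: measurableI => //; have [Qy|nQy] := pselect (Q y);
    [rewrite (_ : [set _ | _] = setT)|rewrite (_ : [set _ | _] = set0)] => //;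
    apply/seteqP; split.
by apply/seteqP; split=> w /= => [Qw|[y _ [-> //]]]; exists (g w).
Qed.

(** The values of probability 0 are at most countably many, so the null events
    on which they are taken have a null union. *)
Lemma ae_fibre_pos (Y : countType) (g : Omega -> Y) :
  (forall y, measurable [set w | g w = y]) ->
  {ae P, forall w, 0 < pr [set v | g v = g w]}.
Proof.
move=> mg.
have : {ae P, forall w, forall k, forall y, unpickle k = Some y ->
    g w = y -> 0 < pr [set v | g v = y]}.
  apply/ae_foralln => k.
  case E: (unpickle k : option Y) => [y|]; last exact: aeW.
  have [y0|y0] := ltP 0 (pr [set v | g v = y]).
    by apply: aeW => w y' [<-].
  exists [set w | g w = y]; split => //.
    rewrite -[LHS]/(P _) prE//; congr EFin; apply/eqP.
    by rewrite eq_le y0 pr_ge0.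
  move=> w /= /existsNP[y' /not_implyP[[<-]] /not_implyP[gw _]].
  exact: gw.
by apply: filterS => w /(_ (pickle (g w)) (g w)); apply; rewrite ?pickleK.
Qed.

Lemma integrable_finite_range (Y : finType) (g : Omega -> Y) (F : Y -> R) :
  (forall y, measurable [set w | g w = y]) ->
  P.-integrable setT (EFin \o (F \o g)).
Proof.
move=> mg.
rewrite (_ : EFin \o _ = fun w =>
    (\sum_(y : Y) (F y)%:E * (\1_[set v | g v = y] w)%:E)%E).
  apply: integrable_sum => // y _; apply: integrableZl => //.
  exact: integrable_indic.
apply/funext => w /=; rewrite (bigD1 (g w))//= big1 ?adde0.
  by rewrite indicE mem_set// mule1.
by move=> y /eqP gy; rewrite indicE memNset ?mule0//= => /esym.
Qed.

Lemma Rintegral_partition (Y : finType) (g : Omega -> Y) (D : set Omega)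
    (f : Omega -> R) :
  (forall y, measurable [set w | g w = y]) -> measurable D ->
  P.-integrable setT (EFin \o f) ->
  \int[P]_(w in D) f w =
  \sum_(y : Y) \int[P]_(w in D `&` [set w | g w = y]) f w.
Proof.
move=> mg mD fi.
pose F y := D `&` [set w | g w = y].
have mF y : measurable (F y) by exact: measurableI.
have DF : D = \big[setU/set0]_(y <- index_enum Y) F y.
  apply/seteqP; split=> w.
    move=> Dw; rewrite -bigcup_seq; exists (g w) => //=; exact: mem_index_enum.
  by rewrite -bigcup_seq => -[y _ []].
rewrite {1}/Rintegral {1}DF integral_bigsetU_EFin//.
- rewrite -sum_fine // => y _; apply: integrable_fin_num => //.
  exact: integrableS fi.
- exact: index_enum_uniq.
- by move=> y z _ _ [w [[_ <-] [_ <-]]].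
- by rewrite -DF; apply/(measurable_int P)/(integrableS _ _ _ fi).
Qed.

Lemma pr_partition (Y : finType) (g : Omega -> Y) (D : set Omega) :
  (forall y, measurable [set w | g w = y]) -> measurable D ->
  pr D = \sum_(y : Y) pr (D `&` [set w | g w = y]).
Proof.
move=> mg mD.
have prI A : measurable A -> pr A = \int[P]_(w in A) (1 : R).
  by move=> mA; rewrite Rintegral_cst// mul1r.
rewrite prI// (Rintegral_partition mg)//; last first.
  exact: finite_measure_integrable_cst.
by apply: eq_bigr => y _; rewrite prI//; exact: measurableI.
Qed.

Lemma Rintegral_null (A : set Omega) (f : Omega -> R) :
  measurable A -> P.-integrable A (EFin \o f) -> pr A = 0 ->
  \int[P]_(w in A) f w = 0.
Proof.
move=> mA fi A0; have PA : P A = 0%E by rewrite prE// A0.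
by rewrite /Rintegral null_set_integral//; exact: measurable_int fi.
Qed.

Lemma pr_pos_nonempty (A : set Omega) : 0 < pr A -> exists w, A w.
Proof.
move=> A0; apply: contrapT => /forallNP nA; move: A0.
by rewrite (_ : A = set0) ?pr0 ?ltxx//; apply/seteqP; split=> w // /nA.
Qed.

(** This is how an almost sure optimality condition is used: on a history of
    positive probability it holds at some outcome, and what it says there
    depends on the history only. *)
Lemma ae_witness (A : set Omega) (Q : Omega -> Prop) :
  measurable A -> 0 < pr A -> {ae P, forall w, Q w} -> exists w, A w /\ Q w.
Proof.
move=> mA A0 [N [mN PN QN]]; apply: contrapT => /forallNP nAQ.
have /negligibleP : P.-negligible A.
  exists N; split=> // w Aw; apply: QN => Qw.
  exact: (nAQ w).
by move=> /(_ mA) PA; move: A0; rewrite /pr PA ltxx.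
Qed.

End DiscreteVariables.

(** * Independence of the primitive sources *)

Section Sources.
Context (R : realType) (X1 X2 U1 U2 : finType).
Context dW1 (W1 : measurableType dW1) dW2 (W2 : measurableType dW2).
Context d (Omega : measurableType d) (P : probability Omega R).
Context (M : model R X1 X2 U1 U2 W1 W2) (S : primitives M P).

(** Agent [i]'s sources in chronological order: place 0 is the initial state and
    place [k > 0] the noise of time [k]. *)
Definition source1 (k : nat) : source := if k is n.+1 then Noise1 n else Init1.
Definition source2 (k : nat) : source := if k is n.+1 then Noise2 n else Init2.

Lemma measurable_init1 (B : set X1) : measurable (init (prim1 S) @^-1` B).
Proof.
exact: (measurable_fibres (g := init (prim1 S)) _ (init_measurable _)).
Qed.

Lemma measurable_init2 (B : set X2) : measurable (init (prim2 S) @^-1` B).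
Proof.
exact: (measurable_fibres (g := init (prim2 S)) _ (init_measurable _)).
Qed.

Lemma measurable_noise1 n A :
  measurable A -> measurable (noise (prim1 S) n.+1 @^-1` A).
Proof.
move=> mA; rewrite -[X in measurable X]setTI; exact: noise_measurable.
Qed.

Lemma measurable_noise2 n A :
  measurable A -> measurable (noise (prim2 S) n.+1 @^-1` A).
Proof.
move=> mA; rewrite -[X in measurable X]setTI; exact: noise_measurable.
Qed.

Lemma measurable_source_event s A :
  source_events (prim1 S) (prim2 S) s A -> measurable A.
Proof.
case: s => [||n|n] /= [B mB <-].
- exact: measurable_init1.
- exact: measurable_init2.
- exact: measurable_noise1.
- exact: measurable_noise2.
Qed.

Lemma prod_double N (F : nat -> R) :
  \prod_(i < N.*2) F i = \prod_(k < N) (F k.*2 * F k.*2.+1).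
Proof.
elim: N => [|N IH]; first by rewrite !big_ord0.
by rewrite doubleS !big_ord_recr /= IH mulrA.
Qed.

(** Independence is given for finite subfamilies enumerated without repetition;
    interleaving the two agents, with the even places for the first and the odd
    ones for the second, turns the sources up to a given time into such an
    enumeration. *)
Lemma pr_sources N (E1 E2 : nat -> set Omega) :
  (forall k, source_events (prim1 S) (prim2 S) (source1 k) (E1 k)) ->
  (forall k, source_events (prim1 S) (prim2 S) (source2 k) (E2 k)) ->
  pr P [set w | forall k, (k < N)%N -> E1 k w /\ E2 k w] =
  \prod_(k < N) (pr P (E1 k) * pr P (E2 k)).
Proof.
move=> hE1 hE2.
pose A (i : nat) := if odd i then E2 i./2 else E1 i./2.
pose src (i : nat) := if odd i then source2 i./2 else source1 i./2.
have srcI : injective src.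
  rewrite /src => i j srcij.
  suff [oij hij] : odd i = odd j /\ i./2 = j./2.
    by rewrite -(odd_double_half i) -(odd_double_half j) oij hij.
  by move: srcij; case: (odd i); case: (odd j);
    case: (i./2) => [|m]; case: (j./2) => [|n] //= [->].
have hA i : source_events (prim1 S) (prim2 S) (src i) (A i).
  by rewrite /src /A; case: (odd i).
have := prim_independent (p := S) (n := N.*2) (j := src \o val)
  (A := A \o val) (inj_comp srcI val_inj) (fun k => hA k).
rewrite (_ : \bigcap_(k in _) _ =
   [set w | forall k, (k < N)%N -> E1 k w /\ E2 k w]); last first.
  apply/seteqP; split=> w /= hw.
    move=> k kN; split.
      have lt : (k.*2 < N.*2)%N by rewrite ltn_double.
      by have := hw (Ordinal lt) I; rewrite /A /= odd_double doubleK.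
    have lt : (k.*2.+1 < N.*2)%N by rewrite ltn_Sdouble.
    by have := hw (Ordinal lt) I; rewrite /A /= odd_double uphalf_double.
  move=> i _; rewrite /A /=.
  have /hw[] : (i./2 < N)%N by rewrite ltn_half_double.
  by case: (odd i).
move=> PE; rewrite {1}/pr PE.
rewrite (eq_bigr (fun i : 'I_(N.*2) => (pr P (A i))%:E)); last first.
  by move=> i _; rewrite -prE//; exact: measurable_source_event (hA _).
rewrite prodEFin /= (prod_double N (fun i => pr P (A i))).
by apply: eq_bigr => k _; rewrite /A /= odd_double doubleK uphalf_double.
Qed.

End Sources.

(** * Independence of future noises from the state and the history *)

Section Trajectories.
Context (R : realType) (X1 X2 U1 U2 : finType).
Context dW1 (W1 : measurableType dW1) dW2 (W2 : measurableType dW2).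
Context d (Omega : measurableType d) (P : probability Omega R).
Context (M : model R X1 X2 U1 U2 W1 W2) (S : primitives M P).
Variable s : strategy X1 X2 U1 U2.

Local Notation history := (seq (period X1 X2)).
Local Notation X := (Xt S s).
Local Notation C := (Ct S s).
Local Notation Cplus := (Ctplus S s).
Local Notation pr := (pr P).

Definition state_history t (x : X1 * X2) (h : history) : set Omega :=
  [set w | X t w = x /\ C t w = h].

Definition kernel1 t x u x' : R :=
  fine (noise_law (agent1 M) [set w | dyn (agent1 M) t x u w = x']).
Definition kernel2 t x u x' : R :=
  fine (noise_law (agent2 M) [set w | dyn (agent2 M) t x u w = x']).

Lemma CplusE t w :
  Cplus t w = rcons (C t w) (announce (d_comm s t (C t w)) (X t w)).
Proof. by []. Qed.

(** Constraints on the noises that have not yet acted at time [t]: the noise of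
    time [t] itself drives the move from [t] to [t.+1]. *)
Definition future t N (A : nat -> set W1) (B : nat -> set W2) : set Omega :=
  [set w | forall k, (t <= k < N)%N ->
     A k (noise (prim1 S) k w) /\ B k (noise (prim2 S) k w)].

Definition moves_to t x (l : ctrl_presc X1 X2 U1 U2) (x' : X1 * X2) :
    set Omega :=
  [set w | dyn (agent1 M) t x.1 (l.1 x.1) (noise (prim1 S) t w) = x'.1 /\
           dyn (agent2 M) t x.2 (l.2 x.2) (noise (prim2 S) t w) = x'.2].

Lemma state_history_init x h :
  state_history 1 x h = [set w | h = [::] /\
    (init (prim1 S) w = x.1 /\ init (prim2 S) w = x.2)].
Proof.
apply/seteqP; split=> w; rewrite /state_history /Xt /Ct /=.
  by move=> [<- <-].
by move=> [-> [-> ->]]; rewrite -surjective_pairing.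
Qed.

Lemma state_history_nil t x' : (0 < t)%N -> state_history t.+1 x' [::] = set0.
Proof.
move=> t0; apply/seteqP; split=> w //=; rewrite /state_history /= Ct_next//.
by case=> _; rewrite CplusE => /(congr1 size); rewrite size_rcons.
Qed.

(** A history of [t.+1] fixes that of [t] and both prescriptions used at time
    [t], so once the state at time [t] is also fixed, reaching [x'] constrains
    nothing but the two noises of that time. *)
Lemma state_history_next t x x' h z : (0 < t)%N ->
  state_history t.+1 x' (rcons h z) `&` [set w | X t w = x] =
  if announce (d_comm s t h) x == z
  then state_history t x h `&` moves_to t x (d_ctrl s t (rcons h z)) x'
  else set0.
Proof.
move=> t0; apply/seteqP; split=> w /=.
  rewrite /state_history /moves_to /= Xt_next// Ct_next// CplusE.
  move=> [[Xx' /rcons_inj[Ch]] + Xx].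
  rewrite Ch Xx => zE; rewrite zE eqxx /=; split; first by [].
  by rewrite -Xx' /Ut /Lambdat CplusE Ch Xx zE.
case: eqP => // zE [[Xx Ch] []].
rewrite /state_history /= Xt_next// Ct_next// /Ut /Lambdat CplusE Xx Ch zE.
by move=> -> ->; rewrite -surjective_pairing.
Qed.

Lemma measurable_moves_to t x l x' : (0 < t)%N ->
  measurable (moves_to t x l x').
Proof.
case: t => // t _; apply: measurableI.
  exact: (measurable_noise1 S t
    (dyn_measurable (agent1 M) t.+1 x.1 (l.1 x.1) x'.1)).
exact: (measurable_noise2 S t
  (dyn_measurable (agent2 M) t.+1 x.2 (l.2 x.2) x'.2)).
Qed.

Lemma measurable_state_history t x h : (0 < t)%N ->
  measurable (state_history t x h).
Proof.
case: t => // t _; elim: t x h => [|t IH] x h.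
  rewrite state_history_init; case: h => [|z h]; last first.
    by rewrite (_ : [set w | _] = set0)//; apply/seteqP; split=> w //= [].
  rewrite (_ : [set w | _] = init (prim1 S) @^-1` [set x.1] `&`
                             init (prim2 S) @^-1` [set x.2]).
    apply: measurableI; [exact: measurable_init1|exact: measurable_init2].
  by apply/seteqP; split=> w /= [].
case/lastP: h => [|h z]; first by rewrite state_history_nil.
rewrite (_ : state_history _ _ _ = \bigcup_(y in [set: X1 * X2])
  (state_history t.+2 x (rcons h z) `&` [set w | X t.+1 w = y])).
  apply: countable_bigcupT_measurable => // y.
  rewrite state_history_next//; case: ifP => // _.
  by apply: measurableI => //; exact: measurable_moves_to.
by apply/seteqP; split=> w => [hw|[y _ []//]]; exists (X t.+1 w).
Qed.

(** Histories are countably many; this gives the measurability of every event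
    expressed by the state and the history of one time. *)
Lemma measurable_state_history_pred t (Q : X1 * X2 -> history -> Prop) :
  (0 < t)%N -> measurable [set w | Q (X t w) (C t w)].
Proof.
move=> t0; apply: (measurable_fibres (g := fun w => (X t w, C t w))
  (fun xh => Q xh.1 xh.2)) => -[x h].
rewrite (_ : [set w | _] = state_history t x h).
  exact: measurable_state_history.
by apply/seteqP; split=> w /= [<- <-].
Qed.

Lemma measurable_future t N A B : (0 < t)%N ->
  (forall k, measurable (A k)) -> (forall k, measurable (B k)) ->
  measurable (future t N A B).
Proof.
move=> t0 mA mB.
rewrite (_ : future _ _ _ _ = \bigcap_(k in [set k | (t <= k < N)%N])
  (noise (prim1 S) k @^-1` A k `&` noise (prim2 S) k @^-1` B k)).
  apply: bigcap_measurableType => -[|k] /= /andP[tk _].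
    by move: (leq_trans t0 tk).
  by apply: measurableI; [exact: measurable_noise1|exact: measurable_noise2].
by apply/seteqP; split=> w /= hw k /hw.
Qed.

Definition noise_prob (A : nat -> set W1) (B : nat -> set W2) k : R :=
  fine (noise_law (agent1 M) (A k)) * fine (noise_law (agent2 M) (B k)).

Lemma pr_init_future N A B x :
  (forall k, measurable (A k)) -> (forall k, measurable (B k)) ->
  pr (state_history 1 x [::] `&` future 1 N.+1 A B) =
  pr (init (prim1 S) @^-1` [set x.1]) * pr (init (prim2 S) @^-1` [set x.2]) *
  \prod_(1 <= k < N.+1) noise_prob A B k.
Proof.
move=> mA mB.
pose E1 k := if k is n.+1 then noise (prim1 S) n.+1 @^-1` A n.+1
             else init (prim1 S) @^-1` [set x.1].
pose E2 k := if k is n.+1 then noise (prim2 S) n.+1 @^-1` B n.+1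
             else init (prim2 S) @^-1` [set x.2].
rewrite (_ : _ `&` _ = [set w | forall k, (k < N.+1)%N -> E1 k w /\ E2 k w]).
  rewrite (pr_sources (S := S)); last 2 first.
  - by case=> [|k] /=; [exists [set x.1]|exists (A k.+1)].
  - by case=> [|k] /=; [exists [set x.2]|exists (B k.+1)].
  rewrite big_ord_recl /=; congr (_ * _).
  rewrite -(big_mkord xpredT (fun k => pr (E1 k.+1) * pr (E2 k.+1))).
  rewrite big_add1 /=; apply: eq_bigr => k _.
  by rewrite /pr !noiseP.
rewrite state_history_init; apply/seteqP; split=> w /=.
  by move=> [[_ [? ?]] fw] [|k] kN //=; apply: fw.
move=> hw; have [? ?] := hw 0%N isT; split => //.
by move=> [|k] // /hw.
Qed.

(** The induction step for [pr_future], before it is known that the first factor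
    is the probability of the event at time [t.+1]. Summing over the state at
    time [t], a move becomes one more constraint on the noises still to come at
    time [t], so the premise at time [t] applies. *)
Lemma pr_step_future t N A B x' h z : (0 < t < N)%N ->
  (forall k, measurable (A k)) -> (forall k, measurable (B k)) ->
  (forall A' B' x, (forall k, measurable (A' k)) ->
    (forall k, measurable (B' k)) ->
    pr (state_history t x h `&` future t N A' B') =
    pr (state_history t x h) * \prod_(t <= k < N) noise_prob A' B' k) ->
  pr (state_history t.+1 x' (rcons h z) `&` future t.+1 N A B) =
  (\sum_x (announce (d_comm s t h) x == z)%:R * pr (state_history t x h) *
     (kernel1 t x.1 ((d_ctrl s t (rcons h z)).1 x.1) x'.1 *
      kernel2 t x.2 ((d_ctrl s t (rcons h z)).2 x.2) x'.2)) *
  \prod_(t.+1 <= k < N) noise_prob A B k.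
Proof.
move=> /andP[t0 tN] mA mB IH.
rewrite (pr_partition P (g := X t)); last 2 first.
- by move=> y; exact: (measurable_state_history_pred (fun x _ => x = y)).
- apply: measurableI; first exact: measurable_state_history.
  exact: measurable_future.
rewrite mulr_suml; apply: eq_bigr => x _.
rewrite setIAC state_history_next//; case: eqP => _; last first.
  by rewrite set0I pr0 !mul0r.
set l := d_ctrl _ _ _.
pose A' k := if k == t then [set w | dyn (agent1 M) t x.1 (l.1 x.1) w = x'.1]
             else A k.
pose B' k := if k == t then [set w | dyn (agent2 M) t x.2 (l.2 x.2) w = x'.2]
             else B k.
rewrite -setIA (_ : _ `&` future _ _ _ _ = future t N A' B').
  rewrite IH; last 2 first.
  - by move=> k; rewrite /A'; case: eqP => // _; exact: dyn_measurable.
  - by move=> k; rewrite /B'; case: eqP => // _; exact: dyn_measurable.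
  rewrite big_ltn// /noise_prob /A' /B' eqxx mul1r -mulrA; congr (_ * (_ * _)).
  apply: eq_big_nat => k /andP[tk _].
  by rewrite (gtn_eqF tk).
apply/seteqP; split=> w.
  move=> [mw fw] k /andP[]; rewrite leq_eqVlt /A' /B' => /predU1P[<-|tk] kN.
    by rewrite eqxx.
  by rewrite (gtn_eqF tk); apply: fw; rewrite tk.
move=> fw; split.
  by have := fw t; rewrite /A' /B' eqxx leqnn tN => /(_ isT).
move=> k /andP[tk kN]; have := fw k.
by rewrite /A' /B' (gtn_eqF tk) kN (ltnW tk) => /(_ isT).
Qed.

(** The noises from time [t] on are independent of the state and history of time
    [t]. Carrying arbitrary constraints on all later noises is what lets the
    induction on [t] go through. *)
Lemma pr_future t N A B x h : (0 < t <= N)%N ->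
  (forall k, measurable (A k)) -> (forall k, measurable (B k)) ->
  pr (state_history t x h `&` future t N A B) =
  pr (state_history t x h) * \prod_(t <= k < N) noise_prob A B k.
Proof.
have futurettT t' A' B' : future t' t' A' B' = setT.
  apply/seteqP; split=> w // _ k /andP[/leq_ltn_trans/[apply]].
  by rewrite ltnn.
case: t => // t; elim: t N A B x h => [|t IH] N A B x h /andP[_ tN] mA mB.
  case: N tN => // N _; case: h => [|z h]; last first.
    rewrite state_history_init (_ : [set w | _] = set0); last first.
      by apply/seteqP; split=> w //= [].
    by rewrite set0I pr0 mul0r.
  rewrite pr_init_future//; congr (_ * _).
  rewrite -[state_history _ _ _]setIT -(futurettT 1%N A B) pr_init_future//.
  by rewrite big_nil mulr1.
case/lastP: h => [|h z]; first by rewrite state_history_nil// set0I pr0 mul0r.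
rewrite pr_step_future//; last first.
  by move=> A' B' y mA' mB'; rewrite IH//= ltnW.
congr (_ * _).
rewrite -[state_history _ _ _]setIT -(futurettT t.+2 A B) pr_step_future//.
- by rewrite big_geq// mulr1.
- by rewrite ltnSn.
- by move=> A' B' y mA' mB'; rewrite IH//=.
Qed.

Lemma pr_state_history_next t x' h z : (0 < t)%N ->
  pr (state_history t.+1 x' (rcons h z)) =
  \sum_x (announce (d_comm s t h) x == z)%:R * pr (state_history t x h) *
     (kernel1 t x.1 ((d_ctrl s t (rcons h z)).1 x.1) x'.1 *
      kernel2 t x.2 ((d_ctrl s t (rcons h z)).2 x.2) x'.2).
Proof.
move=> t0.
rewrite -[state_history t.+1 _ _]setIT
  (_ : setT = future t.+1 t.+1 (fun=> setT) (fun=> setT)); last first.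
  by apply/seteqP; split=> w // _ k /andP[/leq_ltn_trans/[apply]]; rewrite ltnn.
rewrite pr_step_future ?t0 ?leqnn//; first by rewrite big_geq// mulr1.
by move=> A' B' x mA' mB'; rewrite pr_future ?t0 ?leqnSn.
Qed.

End Trajectories.

(** * Beliefs as product posteriors *)

Section Beliefs.
Context (R : realType) (X1 X2 U1 U2 : finType).
Context dW1 (W1 : measurableType dW1) dW2 (W2 : measurableType dW2).
Context d (Omega : measurableType d) (P : probability Omega R).
Context (M : model R X1 X2 U1 U2 W1 W2) (S : primitives M P).
Variable s : strategy X1 X2 U1 U2.

Local Notation X := (Xt S s).
Local Notation C := (Ct S s).
Local Notation Cplus := (Ctplus S s).
Local Notation pr := (pr P).
Local Notation belief := (belief R X1 X2).

(** Given [H], the two local states at time [t] are independent with laws [p.1]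
    and [p.2]. The conditional law is kept multiplied by the probability of
    [H]; the positivity of the latter makes [p] unique. *)
Definition is_posterior (H : set Omega) t (p : belief) : Prop :=
  [/\ 0 < pr H, \sum_x p.1 x = 1, \sum_x p.2 x = 1 &
      forall x, pr ([set w | X t w = x] `&` H) = pr H * (p.1 x.1 * p.2 x.2)].

Lemma sum_prod (F : X1 -> R) (G : X2 -> R) :
  \sum_(x : X1 * X2) F x.1 * G x.2 = (\sum_x F x) * (\sum_y G y).
Proof.
rewrite big_distrl/= -(pair_bigA _ (fun x y => F x * G y))/=.
by apply: eq_bigr => x _; rewrite big_distrr.
Qed.

Lemma measurable_state t x : (0 < t)%N -> measurable [set w | X t w = x].
Proof.
by move=> t0; exact: (measurable_state_history_pred S s (fun y _ => y = x)).
Qed.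

Lemma measurable_history t h : (0 < t)%N -> measurable [set w | C t w = h].
Proof.
by move=> t0; exact: (measurable_state_history_pred S s (fun _ k => k = h)).
Qed.

Lemma measurable_history_plus t h : (0 < t)%N ->
  measurable [set w | Cplus t w = h].
Proof.
move=> t0; exact: (measurable_state_history_pred S s
  (fun x k => rcons k (announce (d_comm s t k) x) = h)).
Qed.

Lemma belief_given_posterior H t p : (0 < t)%N -> measurable H ->
  is_posterior H t p -> belief_given S s H t = p.
Proof.
move=> t0 mH [H0 p1 p2 Hp].
have mQ (Q : X1 * X2 -> Prop) : measurable [set w | Q (X t w)].
  exact: (measurable_state_history_pred S s (fun y _ => Q y)).
rewrite [p]surjective_pairing; congr (_, _); apply/ffunP => x;
  rewrite ffunE /cond_prob -!/(pr _).
  rewrite (pr_partition P (g := fun w => (X t w).2)); last 2 first.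
  - by move=> y; exact: (mQ (fun v => v.2 = y)).
  - by apply: measurableI => //; exact: (mQ (fun v => v.1 = x)).
  rewrite (eq_bigr (fun y => pr H * p.1 x * p.2 y)).
    by rewrite -mulr_sumr p2 mulr1 mulrAC mulfV ?mul1r// gt_eqF.
  move=> y _; rewrite -mulrA -(Hp (x, y)); congr pr.
  by apply/seteqP; split=> w /= => [[[<- Hw] <-]|[-> Hw]//];
    rewrite -surjective_pairing.
rewrite (pr_partition P (g := fun w => (X t w).1)); last 2 first.
- by move=> y; exact: (mQ (fun v => v.1 = y)).
- by apply: measurableI => //; exact: (mQ (fun v => v.2 = x)).
rewrite (eq_bigr (fun y => pr H * p.2 x * p.1 y)).
  by rewrite -mulr_sumr p1 mulr1 mulrAC mulfV ?mul1r// gt_eqF.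
move=> y _; rewrite -mulrA [p.2 x * _]mulrC -(Hp (y, x)); congr pr.
by apply/seteqP; split=> w /= => [[[<- Hw] <-]|[-> Hw]//];
  rewrite -surjective_pairing.
Qed.

Lemma pr_history_plus_state t x h z :
  pr ([set w | X t w = x] `&` [set w | Cplus t w = rcons h z]) =
  (announce (d_comm s t h) x == z)%:R * pr (state_history S s t x h).
Proof.
case: eqP => [zE|nzE]; last first.
  rewrite mul0r (_ : _ `&` _ = set0) ?pr0//; apply/seteqP; split=> w //= [Xx].
  by rewrite CplusE => /rcons_inj[Ch]; rewrite Ch Xx.
rewrite mul1r; congr pr; apply/seteqP; split=> w /= [Xx].
  by rewrite CplusE => /rcons_inj[Ch _]; split.
by move=> Ch; split => //; rewrite CplusE Ch Xx zE.
Qed.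

Lemma pr_history_plus t p h z : (0 < t)%N ->
  is_posterior [set w | C t w = h] t p ->
  pr [set w | Cplus t w = rcons h z] =
  \sum_x (announce (d_comm s t h) x == z)%:R *
     (pr [set w | C t w = h] * (p.1 x.1 * p.2 x.2)).
Proof.
move=> t0 [_ _ _ Hp].
rewrite (pr_partition P (g := X t)); last 2 first.
- by move=> x; exact: measurable_state.
- exact: measurable_history_plus.
by apply: eq_bigr => x _; rewrite setIC pr_history_plus_state -Hp.
Qed.

(** Bayes' rule for the communication stage. The state [x] gives the period [z]
    with probability 0 or 1. If [z] reveals a state then only that state gives
    it; if [z] is blank then the states giving it form a rectangle, and
    restricting a product law to a rectangle leaves a product law. Positivity
    of the event keeps the denominators in [eta] away from 0. *)
Lemma posterior_comm t p h z : (0 < t)%N ->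
  is_posterior [set w | C t w = h] t p ->
  0 < pr [set w | Cplus t w = rcons h z] ->
  is_posterior [set w | Cplus t w = rcons h z] t (eta p (d_comm s t h) z.1).
Proof.
move=> t0 post Cp0; have prC := pr_history_plus z t0 post.
have [C0 p1 p2 Hp] := post.
set g := d_comm s t h in prC *; set m := pr _ in Hp prC C0.
have [x0 x0z] : exists x, announce g x = z.
  apply: contrapT => /forallNP nz; move: Cp0; rewrite prC big1 ?ltxx// => x _.
  by case: eqP => [/nz//|_]; rewrite mul0r.
have Hpp x : pr ([set w | X t w = x] `&` [set w | Cplus t w = rcons h z]) =
    (announce g x == z)%:R * (m * (p.1 x.1 * p.2 x.2)).
  by rewrite pr_history_plus_state -Hp.
case: z => -[y|] b /= in prC Cp0 x0z Hpp *.
  have annE x : (announce g x == (Some y, b)) = (x == y).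
    move: x0z; rewrite /announce; case: ifP => // gx0 [<- <-].
    apply/eqP/eqP => [[]|->]; last by rewrite gx0.
    by case: ifP => // _ [].
  have prCy : pr [set w | Cplus t w = rcons h (Some y, b)] =
      m * (p.1 y.1 * p.2 y.2).
    rewrite prC (bigD1 y)//= annE eqxx mul1r big1 ?addr0// => x /negPf xy.
    by rewrite annE xy mul0r.
  split=> //=.
  - rewrite (bigD1 y.1)//= ffunE eqxx big1 ?addr0// => x /negPf xy.
    by rewrite ffunE xy.
  - rewrite (bigD1 y.2)//= ffunE eqxx big1 ?addr0// => x /negPf xy.
    by rewrite ffunE xy.
  - move=> x; rewrite Hpp annE prCy !ffunE -natrM mulnb -pair_eqE /=.
    rewrite -/(pair_eq x y) pair_eqE.
    by case: eqP => [->|_]; rewrite ?mul1r ?mulr1 ?mul0r ?mulr0.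
have annE x : (announce g x == (None, b)) = ~~ g.1 x.1 && ~~ g.2 x.2.
  move: x0z; rewrite /announce; case: ifP => // /negbT.
  rewrite negb_or => /andP[/negPf -> /negPf ->] [<-].
  rewrite -negb_or; case: ifP => [//|] /negbT; rewrite negb_or.
  by move=> /andP[/negPf -> /negPf ->]; rewrite eqxx.
pose D1 := \sum_x (~~ g.1 x)%:R * p.1 x.
pose D2 := \sum_x (~~ g.2 x)%:R * p.2 x.
have prCD : pr [set w | Cplus t w = rcons h (None, b)] = m * (D1 * D2).
  rewrite prC /D1 /D2 -sum_prod mulr_sumr; apply: eq_bigr => x _.
  by rewrite annE -mulnb natrM mulrCA mulrACA.
have D12 : D1 * D2 != 0.
  by move: Cp0; rewrite prCD pmulr_rgt0// => /gt_eqF/negbT.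
have [D10 D20] : D1 != 0 /\ D2 != 0.
  by move: D12; rewrite mulf_eq0 negb_or => /andP.
split=> //=.
- under eq_bigr do rewrite ffunE.
  by rewrite -mulr_suml mulfV.
- under eq_bigr do rewrite ffunE.
  by rewrite -mulr_suml mulfV.
- move=> x; rewrite Hpp annE prCD !ffunE -/D1 -/D2 -mulnb natrM.
  rewrite -[RHS]mulrA [X in _ = m * X]mulrACA [D1 * _]mulrC [D2 * _]mulrC.
  by rewrite !mulfVK// mulrCA mulrACA.
Qed.

Lemma sum_kernel1 t x u : \sum_x' kernel1 M t x u x' = 1.
Proof.
rewrite -(prT (noise_law (agent1 M))).
rewrite (pr_partition (noise_law (agent1 M)) (g := dyn (agent1 M) t x u))//.
  by apply: eq_bigr => y _; rewrite setTI.
by move=> y; exact: dyn_measurable.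
Qed.

Lemma sum_kernel2 t x u : \sum_x' kernel2 M t x u x' = 1.
Proof.
rewrite -(prT (noise_law (agent2 M))).
rewrite (pr_partition (noise_law (agent2 M)) (g := dyn (agent2 M) t x u))//.
  by apply: eq_bigr => y _; rewrite setTI.
by move=> y; exact: dyn_measurable.
Qed.

(** The control stage brings no new information: given the states, the agents
    move with independent noises, so a product law is carried to a product
    law. *)
Lemma posterior_ctrl t q h : (0 < t)%N ->
  is_posterior [set w | Cplus t w = h] t q ->
  is_posterior [set w | C t.+1 w = h] t.+1 (beta M t q (d_ctrl s t h)).
Proof.
move=> t0; case/lastP: h => [|h z] [Cp0 q1 q2 Hq].
  exfalso; move: Cp0; rewrite (_ : [set w | _] = set0) ?pr0 ?ltxx//.
  apply/seteqP; split=> w //=.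
  by rewrite CplusE => /(congr1 size); rewrite size_rcons.
have CE : [set w | C t.+1 w = rcons h z] = [set w | Cplus t w = rcons h z].
  by apply/seteqP; split=> w /=; rewrite Ct_next.
set l := d_ctrl _ _ _; split.
- by rewrite CE.
- under eq_bigr do rewrite ffunE.
  rewrite exchange_big/= -[RHS]q1; apply: eq_bigr => x _.
  by rewrite -mulr_suml (sum_kernel1 t x) mul1r.
- under eq_bigr do rewrite ffunE.
  rewrite exchange_big/= -[RHS]q2; apply: eq_bigr => x _.
  by rewrite -mulr_suml (sum_kernel2 t x) mul1r.
- move=> x'; rewrite -/(state_history S s t.+1 x' _) pr_state_history_next// CE.
  rewrite !ffunE -sum_prod mulr_sumr; apply: eq_bigr => x _.
  rewrite -pr_history_plus_state Hq -mulrA; congr (_ * _).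
  by rewrite mulrC mulrACA.
Qed.

Lemma posterior_init : is_posterior [set w | C 1 w = [::]] 1
  (init_law (agent1 M), init_law (agent2 M)).
Proof.
have CT : [set w | C 1 w = [::]] = setT by apply/seteqP.
rewrite CT; split=> /=.
- by rewrite prT.
- rewrite -(prT P) (pr_partition P (g := init (prim1 S)))//; last first.
    exact: init_measurable.
  by apply: eq_bigr => x _; rewrite setTI /pr initP.
- rewrite -(prT P) (pr_partition P (g := init (prim2 S)))//; last first.
    exact: init_measurable.
  by apply: eq_bigr => x _; rewrite setTI /pr initP.
- move=> x.
  have := pr_init_future S s 0 x (fun=> measurableT) (fun=> measurableT).
  rewrite big_geq// mulr1 prT mul1r /pr !initP /= => <-.
  congr fine; congr (P _).
  apply/seteqP; split=> w /= [Xx _]; split=> //; first by case: Xx.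
Qed.

(** The common information only grows, which is why it determines all the
    earlier prescriptions and conditioning on these as well changes nothing. *)
Lemma history_prefix r t v w : (0 < r <= t)%N -> C t v = C t w -> C r v = C r w.
Proof.
case/andP=> r0; elim: t => [|t IH]; first by case: r r0.
rewrite leq_eqVlt => /predU1P[->//|rt].
rewrite !Ct_next ?(leq_trans r0)// !CplusE => /rcons_inj/(congr1 fst).
exact: IH.
Qed.

Lemma info_event t w : (0 < t)%N ->
  [set v | info S s t v = info S s t w] = [set v | C t v = C t w].
Proof.
move=> t0; apply/seteqP; split=> v /=; first by case.
move=> Cvw; rewrite /info Cvw; congr (_, _, _); apply/eq_in_map => r;
  rewrite mem_iota add1n prednK// => /andP[r0 rt].
  by rewrite /Gammat (history_prefix _ Cvw)// r0 ltnW.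
by rewrite /Lambdat -!Ct_next// (history_prefix _ Cvw)//.
Qed.

Lemma info_plus_event t w : (0 < t)%N ->
  [set v | info_plus S s t v = info_plus S s t w] =
  [set v | Cplus t v = Cplus t w].
Proof.
move=> t0; apply/seteqP; split=> v /=; first by case.
move=> Cvw'; have := Cvw'; rewrite -!Ct_next// => Cvw.
rewrite /info_plus Cvw'; congr (_, _, _); apply/eq_in_map => r;
  rewrite mem_iota add1n ?prednK// => /andP[r0 rt].
  by rewrite /Gammat (history_prefix _ Cvw)// r0 ltnW.
by rewrite /Lambdat -!Ct_next// (history_prefix _ Cvw)//= ltnS ltnW.
Qed.

Lemma Pit_posterior t w p : (0 < t)%N ->
  is_posterior [set v | C t v = C t w] t p -> Pit S s t w = p.
Proof.
move=> t0; rewrite /Pit info_event//; apply: belief_given_posterior => //.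
exact: measurable_history.
Qed.

Lemma Pitplus_posterior t w q : (0 < t)%N ->
  is_posterior [set v | Cplus t v = Cplus t w] t q -> Pitplus S s t w = q.
Proof.
move=> t0; rewrite /Pitplus info_plus_event//.
apply: belief_given_posterior => //; exact: measurable_history_plus.
Qed.

End Beliefs.

(** * Verification by backward induction *)

Section Verification.
Context (R : realType) (X1 X2 U1 U2 : finType).
Context dW1 (W1 : measurableType dW1) dW2 (W2 : measurableType dW2).
Context d (Omega : measurableType d) (P : probability Omega R).
Context (M : model R X1 X2 U1 U2 W1 W2) (S : primitives M P).
Variable s : strategy X1 X2 U1 U2.

Local Notation X := (Xt S s).
Local Notation C := (Ct S s).
Local Notation Cplus := (Ctplus S s).
Local Notation pr := (pr P).
Local Notation belief := (belief R X1 X2).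
Local Notation T := (horizon M).
Local Notation is_posterior := (is_posterior S s).

(** The blank and the revealing terms of the objective together form a single
    expectation over the states, in which the belief is updated by whatever is
    announced. *)
Lemma comm_objectiveE (Vp : belief -> R) p g :
  comm_objective M Vp p g =
  \sum_(x : X1 * X2) p.1 x.1 * p.2 x.2 *
    (rho M * ((announce g x).1 : bool)%:R + Vp (eta p g (announce g x).1)).
Proof.
rewrite /comm_objective /prob_blank /prob_reveal.
rewrite !(pair_bigA _ (fun x y => _))/= mulr_sumr mulr_suml -!big_split/=.
apply: eq_bigr => -[x1 x2] _; rewrite /announce /=.
by case: (g.1 x1) => /=; case: (g.2 x2) => /=;
  rewrite !(mul0r, mul1r, mulr0, mulr1, addr0, add0r) ?mulrDr ?[rho M * _]mulrC.
Qed.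

Definition period_cost t (w : Omega) : R :=
  cost M t (X t w).1 (X t w).2 (Ut S s t w).1 (Ut S s t w).2 +
  rho M * (Mort S s t w)%:R.

Definition cost_from t (w : Omega) : R := \sum_(t <= r < T.+1) period_cost r w.

(** The cost of a period is a function of finitely many possible states, actions
    and communication decisions. *)
Lemma integrable_period_cost t : (0 < t)%N ->
  P.-integrable setT (EFin \o period_cost t).
Proof.
move=> t0.
pose F (y : (X1 * X2) * (U1 * U2) * bool) : R :=
  cost M t y.1.1.1 y.1.1.2 y.1.2.1 y.1.2.2 + rho M * y.2%:R.
apply: (integrable_finite_range P (g := fun w =>
  (X t w, Ut S s t w, Mort S s t w)) F).
move=> y.
apply: (measurable_state_history_pred S s (fun x h =>
  let g := d_comm s t h in let l := d_ctrl s t (rcons h (announce g x)) in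
  (x, (l.1 x.1, l.2 x.2), g.1 x.1 || g.2 x.2) = y) t0).
Qed.

Lemma integrable_cost_from t : (0 < t)%N ->
  P.-integrable setT (EFin \o cost_from t).
Proof.
move=> t0.
rewrite (_ : EFin \o _ = fun w =>
   (\sum_(r <- index_iota t T.+1 | (0 < r)%N) (period_cost r w)%:E)%E).
  by apply: integrable_sum => // r /integrable_period_cost.
apply/funext => w /=; rewrite sumEFin big_mkcond /=; congr EFin.
by apply: eq_big_nat => r /andP[tr _]; rewrite (leq_trans t0 tr).
Qed.

Lemma Rintegral_period_cost t q h z : (0 < t)%N ->
  is_posterior [set w | Cplus t w = rcons h z] t q ->
  \int[P]_(w in [set w | Cplus t w = rcons h z]) period_cost t w =
  pr [set w | Cplus t w = rcons h z] *
   (\sum_(x : X1 * X2) cost M t x.1 x.2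
        ((d_ctrl s t (rcons h z)).1 x.1) ((d_ctrl s t (rcons h z)).2 x.2) *
        q.1 x.1 * q.2 x.2 + rho M * (z.1 : bool)%:R).
Proof.
move=> t0 [_ q1 q2 Hq]; set l := d_ctrl _ _ _; set H := [set w | _].
have mH : measurable H by exact: measurable_history_plus.
have mX x : measurable [set w | X t w = x] by exact: measurable_state.
rewrite (Rintegral_partition (g := X t))//; last exact: integrable_period_cost.
have q12 : \sum_(x : X1 * X2) q.1 x.1 * q.2 x.2 = 1.
  by rewrite sum_prod q1 q2 mulr1.
rewrite -[rho M * _]mul1r -[X in X * (rho M * _)]q12 mulr_suml -big_split.
rewrite /= mulr_sumr; apply: eq_bigr => x _.
rewrite (@eq_Rintegral _ _ _ _ _ (fun=> cost M t x.1 x.2 (l.1 x.1) (l.2 x.2) +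
    rho M * (z.1 : bool)%:R)).
  rewrite Rintegral_cst; last exact: measurableI.
  rewrite setIC -/(pr _) Hq -/H mulrCA mulrDl.
  by rewrite [rho M * _ * _]mulrC -[cost _ _ _ _ _ _ * _ * _]mulrA.
move=> w; rewrite inE /H => -[/= Cw Xw].
rewrite /period_cost /Ut /Lambdat Cw Xw; congr (_ + rho M * _%:R).
by move: Cw; rewrite /Ctplus => /rcons_inj[_ <-]; rewrite /Zt; case: ifP.
Qed.

Lemma sum_history_plus t p h (F : period X1 X2 -> R) : (0 < t)%N ->
  is_posterior [set w | C t w = h] t p ->
  \sum_z pr [set w | Cplus t w = rcons h z] * F z =
  pr [set w | C t w = h] *
  \sum_(x : X1 * X2) p.1 x.1 * p.2 x.2 * F (announce (d_comm s t h) x).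
Proof.
move=> t0 post.
under eq_bigr => z _ do rewrite (pr_history_plus _ t0 post) mulr_suml.
rewrite exchange_big/= mulr_sumr; apply: eq_bigr => x _.
rewrite (bigD1 (announce (d_comm s t h) x))//= eqxx mul1r.
rewrite -[X in X + _]mulrA big1 ?addr0// => z.
by rewrite eq_sym => /negPf ->; rewrite !mul0r.
Qed.

Lemma Rintegral_history_plus t h (f : Omega -> R) : (0 < t)%N ->
  P.-integrable setT (EFin \o f) ->
  \int[P]_(w in [set w | C t w = h]) f w =
  \sum_z \int[P]_(w in [set w | Cplus t w = rcons h z]) f w.
Proof.
move=> t0 fi.
pose zt w := announce (d_comm s t (C t w)) (X t w).
rewrite (Rintegral_partition (g := zt))//; last 2 first.
- move=> z; exact: (measurable_state_history_pred S s
    (fun x k => announce (d_comm s t k) x = z)).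
- exact: measurable_history.
apply: eq_bigr => z _; congr Rintegral; apply/seteqP; split=> w /=.
  by move=> [Ch zw]; rewrite CplusE -/(zt w) Ch zw.
by rewrite CplusE => /rcons_inj[].
Qed.

(** The verification argument, by induction on the number [n] of periods left.
    Both halves are proved together because they share the decomposition of the
    remaining cost over the announcements made at time [t]. *)
Lemma cost_from_ge_V n t h p : (0 < t)%N -> (t + n)%N = T.+1 ->
  is_posterior [set w | C t w = h] t p ->
  pr [set w | C t w = h] * V M t p <=
    \int[P]_(w in [set w | C t w = h]) cost_from t w
  /\ (picks_minimizers S s ->
      \int[P]_(w in [set w | C t w = h]) cost_from t w =
      pr [set w | C t w = h] * V M t p).
Proof.
elim: n t h p => [|n IH] t h p t0 tn post.
  rewrite addn0 in tn; rewrite tn V_last mulr0.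
  suff -> : \int[P]_(w in [set w | C T.+1 w = h]) cost_from T.+1 w = 0 by [].
  rewrite (@eq_Rintegral _ _ _ _ _ (fun=> 0)); last first.
    by move=> w _; rewrite /cost_from big_geq.
  by rewrite Rintegral_cst ?mul0r//; exact: measurable_history.
have tT : (1 <= t <= T)%N by rewrite t0 -ltnS -tn addnS ltnS leq_addr.
have stage z : let H := [set w | Cplus t w = rcons h z] in
    let q := eta p (d_comm s t h) z.1 in
    pr H * (rho M * (z.1 : bool)%:R + Vplus M t q) <=
      \int[P]_(w in H) cost_from t w
    /\ (picks_minimizers S s ->
        \int[P]_(w in H) cost_from t w =
        pr H * (rho M * (z.1 : bool)%:R + Vplus M t q)).
  move=> H q.
  have mH : measurable H by exact: measurable_history_plus.
  (* An announcement of probability 0 has no posterior, but contributes 0 to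
     both sides. *)
  have [H0|Hn0] := ltP 0 (pr H); last first.
    have H0 : pr H = 0 by apply/eqP; rewrite eq_le Hn0 pr_ge0.
    rewrite H0 mul0r Rintegral_null//; apply: (integrableS measurableT) => //.
    exact: integrable_cost_from.
  have postH := posterior_comm t0 post H0.
  have CE : [set w | C t.+1 w = rcons h z] = H.
    by apply/seteqP; split=> w /=; rewrite Ct_next.
  have [] := IH t.+1 (rcons h z) _ isT _ (posterior_ctrl t0 postH).
    by rewrite addSnnS.
  rewrite CE -/q; set l := d_ctrl _ _ _ => le_next eq_next.
  (* The last term is the loss incurred after time [t], nonnegative by induction
     and 0 for minimizing prescriptions. *)
  have costE : \int[P]_(w in H) cost_from t w =
      pr H * (rho M * (z.1 : bool)%:R + ctrl_objective M t (V M t.+1) q l) +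
      (\int[P]_(w in H) cost_from t.+1 w - pr H * V M t.+1 (beta M t q l)).
    rewrite (@eq_Rintegral _ _ _ _ _ (fun w =>
      period_cost t w + cost_from t.+1 w)).
      rewrite RintegralD//; last 2 first.
      - by apply: (integrableS measurableT) => //;
          exact: integrable_period_cost.
      - by apply: (integrableS measurableT) => //; exact: integrable_cost_from.
      rewrite (Rintegral_period_cost t0 postH) /ctrl_objective.
      rewrite (pair_bigA _ (fun x y => _))/= -/l -/q -/H.
      rewrite !mulrDr [X in _ = _ + X]addrC !addrA addrK.
      by rewrite [pr H * (rho M * _) + _]addrC.
    by move=> w _; rewrite /cost_from big_ltn//; case/andP: tT.
  have [_ /(_ l) Vle] := min_overP (ctrl_objective M t (V M t.+1) q) l.
  split.
    rewrite costE -[X in X <= _]addr0 lerD ?subr_ge0// ler_pM2l// lerD2l.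
    exact: Vle.
  move=> picks; rewrite costE (eq_next picks) subrr addr0; congr (_ * (_ + _)).
  have [w [Hw [_]]] := ae_witness mH H0 (picks t tT).
  rewrite (_ : Pitplus S s t w = q); last first.
    by apply: Pitplus_posterior; rewrite // [Cplus t w]Hw.
  by rewrite /Lambdat Hw.
rewrite V_rec// Rintegral_history_plus//; last exact: integrable_cost_from.
have [_ /(_ (d_comm s t h)) Vle] :=
  min_overP (comm_objective M (Vplus M t) p) (d_comm s t h).
split.
  apply: (@le_trans _ _ (\sum_z pr [set w | Cplus t w = rcons h z] *
     (rho M * (z.1 : bool)%:R + Vplus M t (eta p (d_comm s t h) z.1)))).
    rewrite (sum_history_plus _ t0 post) -comm_objectiveE.
    by rewrite ler_wpM2l// pr_ge0.
  by apply: ler_sum => z _; case: (stage z).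
move=> picks.
transitivity (\sum_z pr [set w | Cplus t w = rcons h z] *
     (rho M * (z.1 : bool)%:R + Vplus M t (eta p (d_comm s t h) z.1))).
  by apply: eq_bigr => z _; case: (stage z) => _; exact.
rewrite (sum_history_plus _ t0 post) -comm_objectiveE; congr (_ * _).
have [C0 _ _ _] := post.
have [w [/= Cw [+ _]]] :=
  ae_witness (measurable_history S s h t0) C0 (picks t tT).
rewrite (_ : Pit S s t w = p); last by apply: Pit_posterior; rewrite // Cw.
by rewrite /Gammat Cw.
Qed.

End Verification.

(** * Optimality *)

Section ExpectedCost.
Context (R : realType) (X1 X2 U1 U2 : finType).
Context dW1 (W1 : measurableType dW1) dW2 (W2 : measurableType dW2).
Context d (Omega : measurableType d) (P : probability Omega R).
Context (M : model R X1 X2 U1 U2 W1 W2) (S : primitives M P).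
Local Notation V1 := (V M 1 (init_law (agent1 M), init_law (agent2 M))).

Lemma expected_cost_bound (s : strategy X1 X2 U1 U2) :
  (V1%:E <= expected_cost S s)%E /\
  (picks_minimizers S s -> expected_cost S s = V1%:E).
Proof.
have CT : [set w | Ct S s 1 w = [::]] = setT by apply/seteqP.
have costE : expected_cost S s = (\int[P]_w cost_from S s 1 w)%:E.
  rewrite /expected_cost unlock /Rintegral fineK//.
  by apply: integrable_fin_num => //; exact: integrable_cost_from.
have := cost_from_ge_V (ltn0Sn 0) (add1n _) (posterior_init S s).
rewrite CT prT mul1r costE lee_fin => -[le_cost eq_cost].
by split=> // /eq_cost ->.
Qed.

End ExpectedCost.

Section OptimalStrategy.
Context (R : realType) (X1 X2 U1 U2 : finType).
Context dW1 (W1 : measurableType dW1) dW2 (W2 : measurableType dW2).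
Context d (Omega : measurableType d) (P : probability Omega R).
Context (M : model R X1 X2 U1 U2 W1 W2) (S : primitives M P).
Variable l0 : ctrl_presc X1 X2 U1 U2.
Local Notation belief := (belief R X1 X2).
Local Notation pr := (pr P).

Definition argmin (I : finType) (i0 : I) (F : I -> R) : I :=
  odflt i0 [pick i | F i == min_over F].

Lemma argminP (I : finType) (i0 : I) (F : I -> R) : minimizes F (argmin i0 F).
Proof.
rewrite /argmin; case: pickP => [i /eqP//|none].
by have [[i /eqP]] := min_overP F i0; rewrite none.
Qed.

Definition opt_comm t (p : belief) : comm_presc X1 X2 :=
  argmin ([ffun=> false], [ffun=> false]) (comm_objective M (Vplus M t) p).

Definition opt_ctrl t (q : belief) : ctrl_presc X1 X2 U1 U2 :=
  argmin l0 (ctrl_objective M t (V M t.+1) q).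

(** The running state consists of the current time, the belief before
    communication at that time, and the belief after communication at the time
    before; the last one is what the control prescription needs, as it is chosen
    when the period just recorded is already part of the history. *)
Definition track (st : nat * belief * belief) (z : period X1 X2) :
    nat * belief * belief :=
  let: (t, p, _) := st in
  let q := eta p (opt_comm t p) z.1 in (t.+1, beta M t q (opt_ctrl t q), q).

(** The initial value of the third component is never read: control
    prescriptions are only asked for on nonempty histories. *)
Definition tracked (h : seq (period X1 X2)) : nat * belief * belief :=
  let p := (init_law (agent1 M), init_law (agent2 M)) in
  foldl track (1%N, p, p) h.

Definition optimal_strategy : strategy X1 X2 U1 U2 :=
  Strategy (fun t h => opt_comm t (tracked h).1.2)
           (fun t h => opt_ctrl t (tracked h).2).

Local Notation s := optimal_strategy.
Local Notation C := (Ct S s).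
Local Notation Cplus := (Ctplus S s).

(** The tracked beliefs follow the recursion of the posteriors under the very
    strategy that is defined from them. *)
Lemma tracked_rcons t h z : (tracked h).1.1 = t ->
  let q := eta (tracked h).1.2 (d_comm s t h) z.1 in
  tracked (rcons h z) = (t.+1, beta M t q (d_ctrl s t (rcons h z)), q).
Proof.
move=> tE; have E : tracked (rcons h z) = track (tracked h) z.
  by rewrite /tracked foldl_rcons.
by rewrite /= E; move: tE; case: (tracked h) => -[t' p q'] /= ->.
Qed.

Lemma pr_history_plus_le t h z : (0 < t)%N ->
  0 < pr [set w | Cplus t w = rcons h z] -> 0 < pr [set w | C t w = h].
Proof.
move=> t0 /lt_le_trans; apply.
have mp := measurable_history_plus S s (rcons h z) t0.
have mC := measurable_history S s h t0.
rewrite -lee_fin -!prE//; apply: le_measure; rewrite ?inE//.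
by move=> w /=; rewrite CplusE => /rcons_inj[].
Qed.

Lemma tracked_posterior t h : (0 < t)%N -> 0 < pr [set w | C t w = h] ->
  (tracked h).1.1 = t /\ is_posterior S s [set w | C t w = h] t (tracked h).1.2.
Proof.
case: t => // t _; elim: t h => [|t IH] h C0.
  have [w /= Cw] := pr_pos_nonempty C0.
  by rewrite -Cw; split=> //; exact: posterior_init.
have [w /=] := pr_pos_nonempty C0.
rewrite Ct_next// CplusE; set z := announce _ _; set h' := Ct _ _ _ _ => hE.
have CE : [set w | C t.+2 w = h] = [set w | Cplus t.+1 w = rcons h' z].
  by apply/seteqP; split=> v /=; rewrite Ct_next// hE.
have Cp0 : 0 < pr [set w | Cplus t.+1 w = rcons h' z] by rewrite -CE.
have [tE post] := IH _ (pr_history_plus_le (ltn0Sn t) Cp0).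
have := posterior_ctrl (ltn0Sn t) (posterior_comm (ltn0Sn t) post Cp0).
by rewrite -hE (tracked_rcons z tE).
Qed.

Lemma tracked_posterior_plus t h z : (0 < t)%N ->
  0 < pr [set w | Cplus t w = rcons h z] ->
  is_posterior S s [set w | Cplus t w = rcons h z] t (tracked (rcons h z)).2.
Proof.
move=> t0 Cp0.
have [tE post] := tracked_posterior t0 (pr_history_plus_le t0 Cp0).
by rewrite (tracked_rcons z tE); exact: posterior_comm.
Qed.

Lemma optimal_strategy_picks : picks_minimizers S s.
Proof.
move=> t /andP[t0 _].
have := ae_fibre_pos P (fun h => measurable_history_plus S s h t0).
apply: filterS => w; rewrite CplusE => Cp0.
have [_ post] := tracked_posterior t0 (pr_history_plus_le t0 Cp0).
have postp := tracked_posterior_plus t0 Cp0.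
rewrite -CplusE in postp.
rewrite (Pit_posterior t0 post) (Pitplus_posterior t0 postp); split.
  exact: argminP.
exact: argminP.
Qed.

End OptimalStrategy.

Theorem theorem1 (R : realType) (X1 X2 U1 U2 : finType)
    (dW1 : measure_display) (W1 : measurableType dW1)
    (dW2 : measure_display) (W2 : measurableType dW2)
    (d : measure_display) (Omega : measurableType d)
    (P : probability Omega R)
    (M : model R X1 X2 U1 U2 W1 W2) (S : primitives M P)
    (U1_nonempty : (0 < #|U1|)%N) (U2_nonempty : (0 < #|U2|)%N) :
  (exists s : strategy X1 X2 U1 U2, picks_minimizers S s) /\
  (forall s : strategy X1 X2 U1 U2, picks_minimizers S s ->
     forall s' : strategy X1 X2 U1 U2,
       (expected_cost S s <= expected_cost S s')%E).
Proof.
split.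
  have /card_gt0P[u1 _] := U1_nonempty; have /card_gt0P[u2 _] := U2_nonempty.
  exists (optimal_strategy M ([ffun=> u1], [ffun=> u2])).
  exact: optimal_strategy_picks.
move=> s s_picks s'.
by rewrite (expected_cost_bound S s).2//; exact: (expected_cost_bound S s').1.
Qed.
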